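(* Let $A,B\in\mathbb{R}^{m\times n}$. The generalized absolute value equation $Ax-B|x|=b$ has a unique solution $x\in\mathbb{R}^n$ for every $b\in\mathbb{R}^m$ if and only if $m=n$ and, for every $D\in[-I_n,I_n]$, the matrix $A+BD$ is nonsingular.
   Context: For $x\in\mathbb{R}^n$, $|x|=(|x_1|,\ldots,|x_n|)^\top$ is the componentwise absolute value. $I_n$ is the $n\times n$ identity matrix. Matrix inequalities are entrywise, and $[-I_n,I_n]=\{D\in\mathbb{R}^{n\times n} : -I_n\le D\le I_n\}$, i.e. the set of diagonal $n\times n$ matrices with diagonal entries in $[-1,1]$. *)

(* Defs.v *)
From mathcomp Require Import all_boot all_order all_algebra.
From mathcomp Require Import reals.

Set Implicit Arguments.
Unset Strict Implicit.
Unset Printing Implicit Defensive.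

Import Order.TTheory GRing.Theory Num.Theory.

Local Open Scope ring_scope.

(* Componentwise absolute value; not to be confused with the matrix norm that
   MathComp-Analysis denotes by `|x|. *)
Definition absmx (R : numDomainType) (m n : nat) (A : 'M[R]_(m, n)) :
  'M[R]_(m, n) := map_mx Num.norm A.

Definition lemx (R : numDomainType) (m n : nat) (A B : 'M[R]_(m, n)) : Prop :=
  forall i j, A i j <= B i j.

(* D ranges over all square matrices: the off-diagonal entries of the two
   bounds are 0, which forces D to be diagonal. *)
Definition in_itvmx (R : numDomainType) (m n : nat) (L U D : 'M[R]_(m, n)) :
  Prop := lemx L D /\ lemx D U.

(* Main.v *)
Require Import Defs.
From mathcomp Require Import all_boot all_order all_algebra.
From mathcomp Require Import reals.
From mathcomp Require Import ring lra.

Set Implicit Arguments.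
Unset Strict Implicit.
Unset Printing Implicit Defensive.

Import Order.TTheory GRing.Theory Num.Theory.

Local Open Scope ring_scope.

(** Write [F x = A x - B |x|].  Everything rests on one property of the pair
    [(A, B)], called regularity below: [A u = B v] with [|v| <= |u|]
    componentwise forces [u = 0].

    Regularity says that no matrix [A + B D] with [-I <= D <= I] kills a
    nonzero vector ([regular_row_full]), because the vectors [v] with
    [|v| <= |u|] are exactly the [D u].  It also says that [F] is injective
    ([regular_inj] and [inj_regular]), because the pairs [(u, v)] with
    [|v| <= |u|] are exactly the pairs [(x - y, |x| - |y|)]: one inclusion is
    the triangle inequality, and the other is solved coordinate by coordinate
    ([abs_diff_witness]).

    Surjectivity of [F] for square regular pairs ([regular_surj]) is obtained by
    replacing the absolute values by linear functions [d_i x_i], [|d_i| <= 1],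
    and restoring them one coordinate at a time.  To restore the coordinate
    [k], take a solution [x] for [d_k = 1] and a solution [y] for [d_k = -1].
    The first one is good if [x_k >= 0], the second one if [y_k <= 0].  If both
    fail, then [x_k < 0 < y_k], so that [|x_k - (- y_k)| <= |x_k - y_k|], and
    regularity applied to [x - y] gives [x_k = y_k], a contradiction.

    Finally [m = n].  As [A] itself has full column rank, [n <= m].  On each
    orthant [F] is linear, so the range of [F] lies in a finite union of
    subspaces of dimension at most [n]; if [n < m], some point of the moment
    curve [(1, t, t^2, ...)] avoids all of them ([avoid_kernels]). *)

(** * Regular pairs of matrices *)

Section Regular.
Variable R : realFieldType.
Implicit Types m n : nat.

Definition regular m n (A B : 'M[R]_(m, n)) :=
  forall u v : 'cV[R]_n,
    (forall i, `|v i 0| <= `|u i 0|) -> A *m u = B *m v -> u = 0.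

Lemma in_itvmx_diag n (D : 'M[R]_n) :
  in_itvmx (- 1%:M) 1%:M D ->
  exists2 d : 'rV[R]_n, D = diag_mx d & forall i, `|d 0 i| <= 1.
Proof.
case=> lo hi; exists (\row_i D i i); last first.
  move=> i; have := lo i i; have := hi i i.
  by rewrite !mxE eqxx mulr1n ler_norml => -> ->.
apply/matrixP=> i j; have := lo i j; have := hi i j.
rewrite !mxE; case: eqVneq => [->|_]; first by rewrite mulr1n.
by rewrite !mulr0n oppr0 => h1 h2; apply/le_anti/andP.
Qed.

Lemma diag_in_itvmx n (d : 'rV[R]_n) :
  (forall i, `|d 0 i| <= 1) -> in_itvmx (- 1%:M) 1%:M (diag_mx d).
Proof.
move=> d1; split=> i j; rewrite !mxE; case: eqVneq => [->|_];
  rewrite ?mulr1n ?mulr0n ?oppr0 //; by have := d1 j; rewrite ler_norml => /andP[].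
Qed.

Lemma mul_diag_col n (d : 'rV[R]_n) (u : 'cV[R]_n) i :
  (diag_mx d *m u) i 0 = d 0 i * u i 0.
Proof. by rewrite mul_diag_mx mxE. Qed.

Lemma row_full_inj m n (M : 'M[R]_(m, n)) (u : 'cV[R]_n) :
  row_full M -> M *m u = 0 -> u = 0.
Proof.
by move=> /row_fullP[N NM] Mu0; rewrite -[u]mul1mx -NM -mulmxA Mu0 mulmx0.
Qed.

Lemma inj_row_full m n (M : 'M[R]_(m, n)) :
  (forall u : 'cV[R]_n, M *m u = 0 -> u = 0) -> row_full M.
Proof.
move=> injM; rewrite -[M]trmxK /row_full mxrank_tr -/(row_free M^T).
rewrite -kermx_eq0; apply/eqP/row_matrixP=> i; rewrite row0.
apply: trmx_inj; rewrite trmx0; apply: injM.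
by rewrite -{1}[M]trmxK -trmx_mul -row_mul mulmx_ker row0 trmx0.
Qed.

(** The vectors [v] with [|v| <= |u|] are the [D u] with [-I <= D <= I]: take
    the quotients [v_i / u_i] as diagonal entries; where [u_i = 0], also
    [v_i = 0] and any entry will do. *)
Lemma regular_row_full m n (A B : 'M[R]_(m, n)) :
  regular A B <->
  (forall D, in_itvmx (- 1%:M) 1%:M D -> row_full (A + B *m D)%R).
Proof.
split=> [reg D|full u v le_vu AuBv].
  move=> /in_itvmx_diag[d -> d1]; apply: inj_row_full => u Mu0.
  apply: (reg u (- (diag_mx d *m u))) => [i|].
    by rewrite [X in `|X| <= _]mxE normrN mul_diag_col normrM ler_piMl.
  by apply/eqP; rewrite mulmxN -addr_eq0 mulmxA -mulmxDl Mu0.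
pose d : 'rV[R]_n := \row_i (- (v i 0 / u i 0)).
have d1 i : `|d 0 i| <= 1.
  rewrite mxE normrN normf_div; have [->|u0] := eqVneq (u i 0) 0.
    by rewrite normr0 invr0 mulr0.
  by rewrite ler_pdivrMr ?normr_gt0 // mul1r.
have Dv : diag_mx d *m u = - v.
  apply/colP=> i; rewrite mul_diag_col !mxE mulNr.
  have := le_vu i; have [->|u0] := eqVneq (u i 0) 0; last by rewrite divfK.
  by rewrite normr0 normr_le0 => /eqP->; rewrite mulr0.
apply: (row_full_inj (full _ (diag_in_itvmx d1))).
by rewrite mulmxDl -mulmxA Dv mulmxN AuBv subrr.
Qed.

(** Opposite signs for [x] and [y] make the system
    [x - y = u], [|x| - |y| = v] linear. *)
Lemma abs_diff_witness (u v : R) :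
  `|v| <= `|u| -> {x : R & {y : R | x - y = u & `|x| - `|y| = v}}.
Proof.
move=> le_vu; have [u0|u0] := leP 0 u.
  exists ((u + v) / 2), ((v - u) / 2); first by field.
  move: le_vu; rewrite (ger0_norm u0) ler_norml => /andP[h1 h2].
  rewrite ger0_norm; last by lra.
  by rewrite ler0_norm; [field | lra].
exists ((u - v) / 2), (- (u + v) / 2); first by field.
move: le_vu; rewrite (ltr0_norm u0) ler_norml => /andP[h1 h2].
rewrite ler0_norm; last by lra.
by rewrite ger0_norm; [field | lra].
Qed.

Lemma inj_regular m n (A B : 'M[R]_(m, n)) :
  injective (fun x : 'cV[R]_n => A *m x - B *m absmx x) -> regular A B.
Proof.
move=> injF u v le_vu AuBv.
pose w i := abs_diff_witness (le_vu i).
pose x : 'cV[R]_n := \col_i projT1 (w i).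
pose y : 'cV[R]_n := \col_i s2val (projT2 (w i)).
have xyu : x - y = u.
  by apply/colP=> i; rewrite !mxE; exact: s2valP (projT2 (w i)).
have xyv : absmx x - absmx y = v.
  by apply/colP=> i; rewrite !mxE; exact: s2valP' (projT2 (w i)).
suff xy : x = y by rewrite -xyu xy subrr.
apply: injF; apply/eqP; rewrite -subr_eq0; apply/eqP.
have : A *m (x - y) - B *m (absmx x - absmx y) = 0.
  by rewrite xyu xyv AuBv subrr.
rewrite !mulmxBr => <-; apply/colP=> i; rewrite !mxE; ring.
Qed.

Lemma regular_inj m n (A B : 'M[R]_(m, n)) :
  regular A B -> injective (fun x : 'cV[R]_n => A *m x - B *m absmx x).
Proof.
move=> reg x y /eqP; rewrite -subr_eq0 => /eqP Fxy.
apply/eqP; rewrite -subr_eq0; apply/eqP.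
apply: (reg _ (absmx x - absmx y)) => [i|].
  by rewrite !mxE ler_dist_dist.
apply/eqP; rewrite -subr_eq0 -Fxy !mulmxBr; apply/eqP.
by apply/colP=> i; rewrite !mxE; ring.
Qed.

(** * Surjectivity *)

(** Interpolates between the linear map [D x] at [k = 0] and [|x|] at
    [k = n]; in every coordinate it stays 1-Lipschitz when [|d i| <= 1], which
    is what makes regularity applicable at each stage. *)
Definition partial_abs n k (d : 'I_n -> R) (x : 'cV[R]_n) : 'cV[R]_n :=
  \col_i (if (i < k)%N then `|x i 0| else d i * x i 0).

(** Induction on [k], for all slopes [d] at once: the step uses the hypothesis
    for two different slopes in the coordinate being restored. *)
Lemma partial_abs_surj n (A B : 'M[R]_n) k (d : 'I_n -> R) (b : 'cV[R]_n) :
  regular A B -> (k <= n)%N -> (forall i, `|d i| <= 1) ->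
  exists x, A *m x - B *m partial_abs k d x = b.
Proof.
move=> reg; elim: k d => [|k IHk] d lt_kn d1.
  pose D : 'M[R]_n := diag_mx (\row_i - d i).
  have unitM : A + B *m D \in unitmx.
    rewrite -row_full_unit; apply: (regular_row_full _ _).1 => //.
    by apply: diag_in_itvmx => i; rewrite mxE normrN.
  exists (invmx (A + B *m D) *m b); set x := invmx _ *m b.
  have -> : partial_abs 0 d x = - (D *m x).
    by apply/colP=> i; rewrite [RHS]mxE mul_diag_col !mxE mulNr opprK.
  by rewrite mulmxN opprK (mulmxA B) -mulmxDl mulKVmx.
pose dk (c : R) (i : 'I_n) := if i == k :> nat then c else d i.
have dk1 c : `|c| <= 1 -> forall i, `|dk c i| <= 1.
  by move=> c1 i; rewrite /dk; case: ifP.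
have [x Fx] : exists x, A *m x - B *m partial_abs k (dk 1) x = b.
  by apply: IHk (ltnW lt_kn) (dk1 _ _); rewrite normr1.
have [y Fy] : exists y, A *m y - B *m partial_abs k (dk (-1)) y = b.
  by apply: IHk (ltnW lt_kn) (dk1 _ _); rewrite normrN normr1.
pose k0 := Ordinal lt_kn.
have restore c (z : 'cV[R]_n) : c * z k0 0 = `|z k0 0| ->
    partial_abs k (dk c) z = partial_abs k.+1 d z.
  move=> cz; apply/colP=> i; rewrite !mxE /dk [in RHS]ltnS [in RHS]leq_eqVlt.
  case: (eqVneq (i : nat) k) => [ik|_] //=.
  have -> : i = k0 by apply: val_inj.
  by rewrite /= ltnn.
have [x0|x0] := leP 0 (x k0 0).
  by exists x; rewrite -(restore 1) // mul1r ger0_norm.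
have [y0|y0] := leP (y k0 0) 0.
  by exists y; rewrite -(restore (-1)) // mulN1r ler0_norm.
(* Now [x k0 < 0 < y k0]: regularity applied to [x - y] contradicts this. *)
suff /colP/(_ k0) : x - y = 0 by rewrite !mxE; lra.
apply: (reg _ (partial_abs k (dk 1) x - partial_abs k (dk (-1)) y)) => [i|].
  rewrite !mxE /dk; case: ifP => [_|_]; first exact: ler_dist_dist.
  case: eqP => [ik|_].
    have -> : i = k0 by apply: val_inj.
    rewrite [leRHS]ltr0_norm ?ler_norml; lra.
  by rewrite -mulrBr normrM ler_piMl.
apply/eqP; rewrite -subr_eq0 !mulmxBr; apply/eqP.
rewrite -[RHS](subrr b) -{1}Fx -Fy.
by apply/colP=> i; rewrite !mxE; ring.
Qed.

Lemma regular_surj n (A B : 'M[R]_n) (b : 'cV[R]_n) :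
  regular A B -> exists x, A *m x - B *m absmx x = b.
Proof.
move=> reg.
have [|x Fx] := @partial_abs_surj n A B n (fun=> 0) b reg (leqnn n).
  by move=> i; rewrite normr0.
exists x; rewrite -Fx; congr (_ - _ *m _).
by apply/colP=> i; rewrite !mxE ltn_ord.
Qed.

(** * Dimension count *)

Lemma nonroot_exists (p : {poly R}) : p != 0 -> exists t, ~~ root p t.
Proof.
move=> p0; pose s := [seq i%:R : R | i <- iota 0 (size p)].
have [allp|] := boolP (all (root p) s); last first.
  by case/allPn=> t _ pt; exists t.
have uniq_s : uniq s.
  by rewrite map_inj_uniq ?iota_uniq //; apply: mulrIn (oner_neq0 _).
by have := max_poly_roots p0 allp uniq_s; rewrite size_map size_iota ltnn.
Qed.

(** A nonzero linear form restricted to the moment curve is a nonzero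
    polynomial, hence finitely many such forms are simultaneously nonzero at
    some point of the curve. *)
Lemma avoid_kernels m (I : finType) (w : I -> 'rV[R]_m) :
  (forall i, w i != 0) -> exists b : 'cV[R]_m, forall i, w i *m b != 0.
Proof.
move=> w0; pose p := \prod_i rVpoly (w i).
have [|t pt] := @nonroot_exists p.
  apply/prodf_neq0 => i _; apply: contra (w0 i) => /eqP wi0.
  by rewrite -[w i]rVpolyK wi0 linear0.
exists (\col_j t ^+ j) => i; apply: contra pt => /eqP/matrixP/(_ 0 0).
rewrite !mxE => wt0; rewrite /root horner_prod; apply/prodf_eq0; exists i => //.
rewrite horner_poly; apply/eqP; rewrite -[RHS]wt0; apply: eq_bigr => j _.
by rewrite mxE valK.
Qed.

Lemma surj_leq m n (A B : 'M[R]_(m, n)) :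
  (forall b : 'cV[R]_m, exists x : 'cV[R]_n, A *m x - B *m absmx x = b) ->
  (m <= n)%N.
Proof.
move=> surjF; rewrite leqNgt; apply/negP=> lt_nm.
(* Orthants are indexed by the sets [S] of negative coordinates. *)
pose M (S : {set 'I_n}) := A - B *m diag_mx (\row_i (-1) ^+ (i \in S)).
have ker0 S : kermx (M S) != 0.
  rewrite kermx_eq0 /row_free neq_ltn.
  by rewrite (leq_ltn_trans (rank_leq_col _) lt_nm).
pose w S := nz_row (kermx (M S)).
have wM S : w S *m M S = 0 by apply/sub_kermxP; exact: nz_row_sub.
have [|b wb] := @avoid_kernels _ _ w; first by move=> S; rewrite nz_row_eq0.
have [x Fx] := surjF b; pose S := [set i | x i 0 < 0].
suff Mx : M S *m x = b by have := wb S; rewrite -Mx mulmxA wM mul0mx eqxx.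
rewrite -Fx mulmxBl -mulmxA; congr (_ - _ *m _); apply/colP=> i.
rewrite mul_diag_col !mxE inE; have [x0|x0] := ltP (x i 0) 0.
  by rewrite expr1 mulN1r ltr0_norm.
by rewrite expr0 mul1r ger0_norm.
Qed.

End Regular.

Theorem theorem3p2 (R : realType) (m n : nat) (A B : 'M[R]_(m, n)) :
  (forall b : 'cV[R]_m,
     exists! x : 'cV[R]_n, A *m x - B *m absmx x = b)
  <->
  (exists mn : m = n,
     forall D : 'M[R]_n, in_itvmx (- 1%:M) 1%:M D ->
       castmx (mn, erefl n) (A + B *m D) \in unitmx).
Proof.
split=> [uniqF|[mn]].
  have regAB : regular A B.
    apply: inj_regular => x y Fxy.
    have [z [_ zU]] := uniqF (A *m x - B *m absmx x).
    by rewrite -(zU x) // -(zU y).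
  have full := (regular_row_full A B).1 regAB.
  have mn : m = n.
    apply/eqP; rewrite eqn_leq (@surj_leq _ _ _ A B) /=; last first.
      by move=> b; have [x [Fx _]] := uniqF b; exists x.
    have := full (diag_mx 0); rewrite linear0 mulmx0 addr0 => /(_ _)/eqP<-.
      exact: rank_leq_row.
    by rewrite -(linear0 diag_mx); apply: diag_in_itvmx => i; rewrite mxE normr0.
  exists mn => D /full; subst m.
  by rewrite castmx_id row_full_unit.
subst m => unitAB b.
have regAB : regular A B.
  apply/regular_row_full => D /unitAB.
  by rewrite castmx_id row_full_unit.
have [x Fx] := regular_surj b regAB.
exists x; split=> // y Fy; apply: (regular_inj regAB).
by rewrite Fx Fy.
Qed.
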